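(* Let $G=(V,E)$ be a directed acyclic graph and let $(S,T)\in\mathcal M^{\leq 3}(G)$. Let $v\in V$ and $A\subseteq V\setminus\{v\}$. Then the last row (the row indexed by $v$) of the matrix $$\begin{bmatrix} R_{\mathrm{pa}(\{v\}\cup A),\,\mathrm{nd}(\{v\}\cup A)}\\ R_{v,\,\mathrm{nd}(\{v\}\cup A)}\end{bmatrix}$$ is a linear combination of the other rows.
   Context: $V$ is a finite set. For a directed acyclic graph (DAG) $G=(V,E)$, the set of parents of $i\in V$ is $\mathrm{pa}(i)=\{j\in V:(j,i)\in E\}$. The set of non-descendants of $i$, $\mathrm{nd}(i)$, is the set of $j\in V$ such that there is no directed path from $i$ to $j$; the trivial path of length $0$ counts, so $i\notin\mathrm{nd}(i)$. For a set $A\subseteq V$, $$\mathrm{pa}(A):=\Big(\bigcup_{a\in A}\mathrm{pa}(a)\Big)\setminus A,\qquad \mathrm{nd}(A):=\bigcap_{a\in A}\mathrm{nd}(a).$$ $PD(\mathbb R^{|V|})$ is the set of real symmetric positive definite $|V|\times|V|$ matrices $S=(s_{ij})_{i,j\in V}$. $\mathrm{Sym}^3(\mathbb R^{|V|})$ is the space of real symmetric tensors $T=(t_{ijk})_{i,j,k\in V}$. A tensor in $\mathrm{Sym}^3(\mathbb R^{|V|})$ is diagonal if its $(i,j,k)$ entry is $0$ unless $i=j=k$. $\mathbb R^E$ is the set of real $|V|\times|V|$ matrices $\Lambda=(\lambda_{ji})$ with $\lambda_{ji}=0$ whenever $(j,i)\notin E$; for such $\Lambda$ the matrix $I-\Lambda$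 is invertible because $G$ is acyclic. $\bullet$ is the Tucker product: for a tensor $W$ and a matrix $B$, both indexed by $V$, $(W\bullet B\bullet B\bullet B)_{ijk}=\sum_{a,b,c\in V} W_{abc}B_{ai}B_{bj}B_{ck}$. The second- and third-order moment model of $G$ is the set $\mathcal M^{\leq 3}(G)\subseteq PD(\mathbb R^{|V|})\times \mathrm{Sym}^3(\mathbb R^{|V|})$ of all pairs $(S,T)$ of the form $$S=(I-\Lambda)^{-T}\Omega^{(2)}(I-\Lambda)^{-1},\qquad T=\Omega^{(3)}\bullet(I-\Lambda)^{-1}\bullet(I-\Lambda)^{-1}\bullet(I-\Lambda)^{-1},$$ with $\Omega^{(2)}\in PD(\mathbb R^{|V|})$ diagonal, $\Omega^{(3)}\in \mathrm{Sym}^3(\mathbb R^{|V|})$ diagonal and $\Lambda\in\mathbb R^E$. For $A,B,C\subseteq V$: $S_{A,B}$ is the matrix with entries $s_{ab}$, rows indexed by $a\in A$, columns by $b\in B$; $T_{A,B\times C}$ is the matrix with entries $t_{abc}$, rows indexed by $a\in A$ and columns by pairs $(b,c)\in B\times C$; and $$R_{A,B}:=\begin{bmatrix} S_{A,B} & T_{A,\,B\times V}\end{bmatrix}.$$ A single vertex $v$ used as an index set means $\{v\}$. A linear combination of an empty set of rows is the zero row. *)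

(* Defs.v *)
From mathcomp Require Import all_boot all_order all_algebra.
From mathcomp Require Import reals.

Set Implicit Arguments.
Unset Strict Implicit.
Unset Printing Implicit Defensive.

Import GRing.Theory Num.Theory.

Local Open Scope ring_scope.

Section Graphs.

Variable V : finType.

(* [cycle e c] holds for every closed directed walk [c], including the walk
   [:: x] along a self-loop, and for the empty sequence, which is no walk. *)
Definition acyclic (e : rel V) := forall c : seq V, cycle e c -> c = [::].

Definition pa (e : rel V) (i : V) : {set V} := [set j | e j i].

(* [connect e] is reflexive, so a vertex is not its own non-descendant. *)
Definition nd (e : rel V) (i : V) : {set V} := [set j | ~~ connect e i j].

Definition pa_set (e : rel V) (A : {set V}) : {set V} :=
  (\bigcup_(a in A) pa e a) :\: A.

Definition nd_set (e : rel V) (A : {set V}) : {set V} :=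
  \bigcap_(a in A) nd e a.

End Graphs.

Section Moments.

Variables (R : realType) (V : finType).

(* A V x V matrix is stored as a matrix of size #|V|, through the enumeration
   of V; [entry M i j] is its entry at the vertices i and j. *)
Definition entry (M : 'M[R]_#|V|) (i j : V) : R :=
  M (enum_rank i) (enum_rank j).

Definition tensor := {ffun V * V * V -> R}.

Definition posdefmx (S : 'M[R]_#|V|) : Prop :=
  S^T = S /\ forall x : 'cV[R]_#|V|, x != 0 -> 0 < (x^T *m S *m x) 0 0.

(* The two transpositions generate all permutations of the three indices. *)
Definition symmetric_tensor (T : tensor) : Prop :=
  forall i j k : V, T (i, j, k) = T (j, i, k) /\ T (i, j, k) = T (i, k, j).

Definition diagonal_tensor (T : tensor) : Prop :=
  forall i j k : V, ~ (i = j /\ j = k) -> T (i, j, k) = 0.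

Definition edge_matrix (e : rel V) (L : 'M[R]_#|V|) : Prop :=
  forall j i : V, ~~ e j i -> entry L j i = 0.

Definition tucker (W : tensor) (B1 B2 B3 : 'M[R]_#|V|) : tensor :=
  [ffun t => let: (i, j, k) := t in
     \sum_(a : V) \sum_(b : V) \sum_(c : V)
        W (a, b, c) * entry B1 a i * entry B2 b j * entry B3 c k].

Definition moment_model (e : rel V) (S : 'M[R]_#|V|) (T : tensor) : Prop :=
  [/\ posdefmx S, symmetric_tensor T &
  exists (O2 : 'M[R]_#|V|) (O3 : tensor) (L : 'M[R]_#|V|),
    [/\ posdefmx O2 /\ is_diag_mx O2,
        symmetric_tensor O3 /\ diagonal_tensor O3,
        edge_matrix e L,
        S = (invmx (1%:M - L))^T *m O2 *m invmx (1%:M - L) &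
        T = tucker O3 (invmx (1%:M - L)) (invmx (1%:M - L))
                      (invmx (1%:M - L))]].

(* Rows and columns of the submatrices below follow the enumerations of the
   index sets. *)
Definition S_sub (S : 'M[R]_#|V|) (A B : {set V}) : 'M[R]_(#|A|, #|B|) :=
  \matrix_(i, j) entry S (enum_val i) (enum_val j).

Definition T_sub (T : tensor) (A B C : {set V}) :
    'M[R]_(#|A|, #|setX B C|) :=
  \matrix_(i, j) T (enum_val i, (enum_val j).1, (enum_val j).2).

Definition R_mx (S : 'M[R]_#|V|) (T : tensor) (A B : {set V}) :
    'M[R]_(#|A|, #|B| + #|setX B [set: V]|) :=
  row_mx (S_sub S A B) (T_sub T A B [set: V]).

Definition row_combination_of_others (m n : nat) (M : 'M[R]_(m, n))
    (i : 'I_m) : Prop :=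
  exists c : 'I_m -> R, row i M = \sum_(k < m | k != i) c k *: row k M.

End Moments.

(* Main.v *)
Require Import Defs.
From mathcomp Require Import all_boot all_order all_algebra.
From mathcomp Require Import reals.

Set Implicit Arguments.
Unset Strict Implicit.
Unset Printing Implicit Defensive.

Import GRing.Theory.

Local Open Scope ring_scope.

(** Write [N = (I - L)^-1] and, for a vertex [i], let [r i] be the row indexed
    by [i] of the moment matrix with columns restricted to [nd B], where [B] is
    [v |: A].

    The identity [N = I + N L] splits each moment that has [i] as first index
    into the same moments of the parents of [i], weighted by the edge
    coefficients, plus the contribution of the noise of [i] itself
    ([cov_recursion], [third_moment_recursion]).  Since the noise is diagonal,
    that contribution carries a factor [N i j], [j] being the second index.
    [N] is supported on pairs connected by a directed path
    ([entry_inv_disconnected]), so the contribution vanishes as soon as [j] is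
    a non-descendant of [i].  Hence [r i] is the sum of the [L p i *: r p] for
    every [i] in [B].

    It remains to eliminate the vertices of [B] from the right-hand side: a
    parent of [i] lies either in [pa B] or again in [B], and in an acyclic graph
    the substitution can be repeated until only rows of [pa B] are left
    ([recursive_family_span]).  Every step that uses acyclicity is an instance
    of the induction principle [acyclic_ind]. *)

Section AcyclicInduction.

Variables (V : finType) (e : rel V).

(** The number of ancestors of a vertex strictly increases along an edge, for
    otherwise the edge would close a cycle; so it measures an induction in
    which a property is passed from the parents of a vertex to the vertex. *)
Lemma acyclic_ind (P : V -> Prop) : acyclic e ->
  (forall j, (forall p, e p j -> P p) -> P j) -> forall j, P j.
Proof.
move=> ac IH j.
have [n] := ubnP #|[set x | connect e x j]|.
elim: n j => // n IHn j lt_jn; apply: IH => p epj; apply: IHn.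
rewrite -ltnS; apply: leq_trans lt_jn; rewrite ltnS; apply: proper_card.
apply/properP; split.
  apply/subsetP=> x; rewrite !inE => cxp.
  exact: connect_trans cxp (connect1 epj).
exists j; rewrite inE ?connect0 //; apply/negP=> /connectP[s es def_p].
by have := ac (j :: s); rewrite /= rcons_path es -def_p epj => /(_ isT).
Qed.

(** A parent of [w] outside of [B] is a member of [pa_set e B]; a parent inside
    of [B] has, by induction, a row which is already such a combination. *)
Lemma recursive_family_span (K : pzRingType) (M : lmodType K)
    (B : {set V}) (l : V -> V -> K) (r : V -> M) :
  acyclic e ->
  (forall p w, ~~ e p w -> l p w = 0) ->
  (forall w, w \in B -> r w = \sum_p l p w *: r p) ->
  forall w, w \in B ->
    exists c : V -> K, r w = \sum_(q in pa_set e B) c q *: r q.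
Proof.
move=> ac l0 rB; apply: (acyclic_ind ac) => w IH wB.
have span_pa p : exists c : V -> K,
    l p w *: r p = \sum_(q in pa_set e B) c q *: r q.
  have [epw|/l0->] := boolP (e p w); last first.
    by exists (fun _ => 0); rewrite scale0r big1 // => q _; rewrite scale0r.
  have [pB|pNB] := boolP (p \in B).
    have [c ->] := IH p epw pB; exists (fun q => l p w * c q).
    by rewrite scaler_sumr; apply: eq_bigr => q _; rewrite scalerA.
  have p_pa : p \in pa_set e B.
    by rewrite inE pNB; apply/bigcupP; exists w; rewrite ?inE.
  exists (fun q => if q == p then l p w else 0).
  rewrite (bigD1 p p_pa) /= eqxx big1 ?addr0 // => q /andP[_ /negbTE->].
  by rewrite scale0r.
have [c rc] := fin_all_exists span_pa.
exists (fun q => \sum_p c p q); rewrite (rB w wB).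
under eq_bigr do rewrite rc.
by rewrite exchange_big; apply: eq_bigr => q _; rewrite scaler_suml.
Qed.

End AcyclicInduction.

Section Entries.

Variables (R : realType) (V : finType).
Implicit Types M N : 'M[R]_#|V|.

Lemma entry_mul M N i j :
  entry (M *m N) i j = \sum_(k : V) entry M i k * entry N k j.
Proof.
rewrite /entry mxE (reindex (@enum_rank V)) //=.
by apply: onW_bij; apply: enum_rank_bij.
Qed.

Lemma entry_add M N i j : entry (M + N) i j = entry M i j + entry N i j.
Proof. by rewrite /entry mxE. Qed.

Lemma entry_tr M i j : entry M^T i j = entry M j i.
Proof. by rewrite /entry mxE. Qed.

Lemma entry1 i j : entry (1%:M : 'M[R]_#|V|) i j = (i == j)%:R.
Proof. by rewrite /entry mxE (inj_eq enum_rank_inj). Qed.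

Lemma entry_diag M i j : is_diag_mx M -> i != j -> entry M i j = 0.
Proof.
move=> /is_diag_mxP dM neq_ij; apply: dM; apply: contra neq_ij.
by rewrite (inj_eq val_inj) (inj_eq enum_rank_inj).
Qed.

End Entries.

Section Model.

Variables (R : realType) (V : finType) (e : rel V) (L : 'M[R]_#|V|).
Hypotheses (acyclic_e : acyclic e) (eL : edge_matrix e L).

Let N := invmx (1%:M - L).

(** If [u (I - L) = 0] then each coordinate of [u] is a combination of its
    coordinates at the parents, hence zero by induction. *)
Lemma unitmx_edge : 1%:M - L \in unitmx.
Proof.
rewrite -row_free_unit; apply: inj_row_free => u.
rewrite mulmxBr mulmx1 => /eqP; rewrite subr_eq0 => /eqP uL.
suff u0 j : u 0 (enum_rank j) = 0.
  by apply/rowP=> k; rewrite mxE -(enum_valK k) u0.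
move: j; apply: (acyclic_ind acyclic_e) => j IH.
rewrite uL mxE big1 // => k _; rewrite -(enum_valK k).
have [/IH->|/eL] := boolP (e (enum_val k) j); first by rewrite mul0r.
by rewrite /entry => ->; rewrite mulr0.
Qed.

Lemma entry_inv_recursion i j :
  entry N i j = (i == j)%:R + \sum_p entry N i p * entry L p j.
Proof.
rewrite -entry_mul -entry1 -entry_add; congr entry.
by rewrite -(mulVmx unitmx_edge) mulmxBr mulmx1 subrK.
Qed.

(** [N i j] is the sum of the weights of the directed paths from [i] to [j]. *)
Lemma entry_inv_disconnected i j : ~~ connect e i j -> entry N i j = 0.
Proof.
move: j; apply: (acyclic_ind acyclic_e) => j IH nij; rewrite entry_inv_recursion.
have /negbTE-> : i != j by apply: contraNneq nij => ->; apply: connect0.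
rewrite add0r big1 // => p _.
have [epj|/eL->] := boolP (e p j); last by rewrite mulr0.
rewrite IH ?mul0r //; apply: contra nij => cip.
exact: connect_trans cip (connect1 epj).
Qed.

(** Both moments of [w] depend on [w] only through the column [w] of [N], and
    linearly; [f a] below stands for the remaining factors. *)
Lemma inv_column_recursion (f : V -> R) w :
  \sum_a entry N a w * f a =
  f w + \sum_p entry L p w * \sum_a entry N a p * f a.
Proof.
under eq_bigr do rewrite entry_inv_recursion mulrDl.
rewrite big_split /=; congr (_ + _).
  rewrite (bigD1 w) //= eqxx mul1r big1 ?addr0 // => a /negbTE->.
  by rewrite mul0r.
under eq_bigr do rewrite mulr_suml.
rewrite exchange_big; apply: eq_bigr => p _ /=; rewrite mulr_sumr.
by apply: eq_bigr => a _; rewrite mulrA (mulrC (entry L p w)).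
Qed.

Lemma cov_recursion (O : 'M[R]_#|V|) w j :
  is_diag_mx O -> ~~ connect e w j ->
  let S := N^T *m O *m N in
  entry S w j = \sum_p entry L p w * entry S p j.
Proof.
move=> dO nwj S.
have SE i : entry S i j = \sum_a entry N a i * entry (O *m N) a j.
  rewrite /S -mulmxA entry_mul.
  by apply: eq_bigr => a _; rewrite entry_tr.
rewrite SE inv_column_recursion; under [in RHS]eq_bigr do rewrite SE.
rewrite entry_mul big1 ?add0r // => b _.
have [<-|nwb] := eqVneq w b; first by rewrite entry_inv_disconnected ?mulr0.
by rewrite (entry_diag dO nwb) mul0r.
Qed.

Lemma third_moment_recursion (O : tensor R V) w j k :
  diagonal_tensor O -> ~~ connect e w j ->
  let T := tucker O N N N in
  T (w, j, k) = \sum_p entry L p w * T (p, j, k).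
Proof.
move=> dO nwj T.
pose f a := \sum_b \sum_c O (a, b, c) * entry N b j * entry N c k.
have TE i : T (i, j, k) = \sum_a entry N a i * f a.
  rewrite ffunE; apply: eq_bigr => a _; rewrite mulr_sumr.
  apply: eq_bigr => b _; rewrite mulr_sumr.
  by apply: eq_bigr => c _; rewrite (mulrC (O _)) !mulrA.
rewrite TE inv_column_recursion; under [in RHS]eq_bigr do rewrite TE.
rewrite {1}/f big1 ?add0r // => b _; rewrite big1 // => c _.
have [<-|/eqP nwb] := eqVneq w b.
  by rewrite entry_inv_disconnected // mulr0 mul0r.
by rewrite dO ?mul0r // => -[].
Qed.

End Model.

Section Rows.

Variables (R : realType) (V : finType) (S : 'M[R]_#|V|) (T : tensor R V).

(** The rows of [R_mx S T A B] form a family indexed by the positions in [A];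
    naming them by vertices makes them independent of [A]. *)
Definition moment_row (B : {set V}) (i : V) :
    'rV[R]_(#|B| + #|setX B [set: V]|) :=
  row_mx (\row_j entry S i (enum_val j))
         (\row_j T (i, (enum_val j).1, (enum_val j).2)).

Lemma row_R_mx (A B : {set V}) k :
  row k (R_mx S T A B) = moment_row B (enum_val k).
Proof.
by rewrite /R_mx row_row_mx; congr row_mx; apply/rowP=> j; rewrite !mxE.
Qed.

Lemma moment_row_recursion (e : rel V) (B : {set V}) (l : V -> R) w :
  w \in B ->
  (forall j, ~~ connect e w j -> entry S w j = \sum_p l p * entry S p j) ->
  (forall j k, ~~ connect e w j -> T (w, j, k) = \sum_p l p * T (p, j, k)) ->
  moment_row (nd_set e B) w = \sum_p l p *: moment_row (nd_set e B) p.
Proof.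
move=> wB Sw Tw.
have ndB j : j \in nd_set e B -> ~~ connect e w j.
  by move=> /bigcapP/(_ w wB); rewrite inE.
apply/rowP=> k; rewrite summxE -(splitK k); case: (split k) => j /=.
  rewrite row_mxEl mxE Sw ?ndB ?enum_valP //.
  by apply: eq_bigr => p _; rewrite mxE row_mxEl mxE.
have := enum_valP j; rewrite inE => /andP[jB _].
rewrite row_mxEr mxE Tw ?ndB //.
by apply: eq_bigr => p _; rewrite mxE row_mxEr mxE.
Qed.

End Rows.

Theorem proposition4p2 (R : realType) (V : finType) (e : rel V)
    (acyclic_e : acyclic e) (S : 'M[R]_#|V|) (T : tensor R V)
    (model_ST : moment_model e S T)
    (v : V) (A : {set V}) (vNA : A \subset [set: V] :\ v) :
  row_combination_of_others
    (col_mx (R_mx S T (pa_set e (v |: A)) (nd_set e (v |: A)))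
            (R_mx S T [set v] (nd_set e (v |: A))))
    (rshift #|pa_set e (v |: A)| (enum_rank_in (set11 v) v)).
Proof.
case: model_ST => _ _ [O2 [O3 [L [[_ dO2] [_ dO3] eL defS defT]]]].
set B := v |: A.
have vB : v \in B by rewrite setU11.
have rB w : w \in B ->
    moment_row S T (nd_set e B) w =
    \sum_p entry L p w *: moment_row S T (nd_set e B) p.
  move=> wB; apply: moment_row_recursion => // j.
    by rewrite defS; apply: cov_recursion.
  by rewrite defT => k; apply: third_moment_recursion.
have [c rv] := recursive_family_span acyclic_e eL rB vB.
(* The bottom block has a single row, the one of [v] itself; its coefficient
   is set to 0. *)
exists (fun k => if split k is inl a then c (enum_val a) else 0).
rewrite rowKd row_R_mx enum_rankK_in ?set11 // rv big_split_ord /=.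
rewrite [X in _ = _ + X]big1 ?addr0 => [|k _]; last first.
  by rewrite (unsplitK (inr k)) scale0r.
rewrite big_enum_val; apply: eq_big => k; rewrite ?eq_lrshift // => _.
by rewrite (unsplitK (inl k)) rowKu row_R_mx.
Qed.
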